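(* Let $X$ be a set with $|X|\ge 3$, let $n\ge 3$ be an integer, and let $F\colon X^n\to X$ be an associative operation. Then $E_F=X$ if and only if $(X,F)$ is the $n$-ary extension of an Abelian group whose exponent divides $n-1$.
   Context: Notation: $k\boldsymbol{\cdot} x$ stands for the $k$-tuple $x,\ldots,x$. An operation $F\colon X^n\to X$ is associative if $F(x_1,\ldots,x_{i-1},F(x_i,\ldots,x_{i+n-1}),x_{i+n},\ldots,x_{2n-1})=F(x_1,\ldots,x_i,F(x_{i+1},\ldots,x_{i+n}),x_{i+n+1},\ldots,x_{2n-1})$ for all $x_1,\ldots,x_{2n-1}\in X$ and $1\le i\le n-1$. An element $e\in X$ is neutral for $F\colon X^n\to X$ if $F((k-1)\boldsymbol{\cdot} e,x,(n-k)\boldsymbol{\cdot} e)=x$ for all $x\in X$ and $k\in\{1,\ldots,n\}$; $E_F$ is the set of neutral elements of $F$. For a binary associative $G\colon X^2\to X$, define $G^1=G$ and $G^m(x_1,\ldots,x_{m+1})=G^{m-1}(x_1,\ldots,x_{m-1},G(x_m,x_{m+1}))$ for $m\ge 2$; $(X,G^{n-1})$ is called the $n$-ary extension of $(X,G)$. The exponent of a group is the smallest integer $r\ge 1$ (if any) such that the $r$-th power of every element is the neutral element. *)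

(* Defs.v *)
From mathcomp Require Import all_boot.
From mathcomp Require Import boolp classical_sets.

Set Implicit Arguments.
Unset Strict Implicit.
Unset Printing Implicit Defensive.

Section NaryOperations.
Variables (X : Type) (n : nat) (F : n.-tuple X -> X).

(* The arguments (x_0, ..., x_{i-1}, F (x_i, ..., x_{i+n-1}), x_{i+n}, ...,
   x_{2n-2}), counting from 0.  For i < n only the first 2n-1 terms of the
   sequence x are used. *)
Definition nest (x : nat -> X) (i : nat) : n.-tuple X :=
  [tuple if j < i then x j
         else if val j == i then F [tuple x (i + k) | k < n]
         else x (j + n.-1) | j < n].

Definition nary_associative : Prop :=
  forall (x : nat -> X) (i : nat), i.+1 < n -> F (nest x i) = F (nest x i.+1).

Definition neutral (e : X) : Prop :=
  forall (x : X) (k : 'I_n), F [tuple if j == k then x else e | j < n] = x.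

Definition neutral_elements : set X := [set e | neutral e]%classic.

End NaryOperations.

Section BinaryOperations.
Variables (X : Type) (G : X -> X -> X).

(* (x_0, ..., x_{m+1}) |-> (x_0, ..., x_{m-1}, G x_m x_{m+1}) *)
Definition merge_last (m : nat) (x : m.+2.-tuple X) : m.+1.-tuple X :=
  [tuple if j < m then tnth x (inord j)
         else G (tnth x (inord m)) (tnth x (inord m.+1)) | j < m.+1].

(* G^m; the recursion is started one step early, at the identity G^0, which
   gives G^1 (x_0, x_1) = G x_0 x_1. *)
Fixpoint iterated_op (m : nat) : m.+1.-tuple X -> X :=
  match m with
  | 0 => fun x => thead x
  | m'.+1 => fun x => iterated_op (merge_last x)
  end.

(* The tuple y is x itself, its length n being written n.-1.+1 (for 0 < n). *)
Definition nary_extension (n : nat) (F : n.-tuple X -> X) : Prop :=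
  forall (x : n.-tuple X) (y : n.-1.+1.-tuple X),
    y = x :> seq X -> F x = iterated_op y.

Record abelian_group (e : X) (inv : X -> X) : Prop := AbelianGroup {
  abelian_group_assoc : associative G;
  abelian_group_comm : commutative G;
  abelian_group_left_id : left_id e G;
  abelian_group_left_inv : left_inverse e inv G
}.

Definition annihilates (e : X) (r : nat) : Prop :=
  forall x : X, iterop r G x e = e.

Definition group_exponent (e : X) (r : nat) : Prop :=
  [/\ 0 < r, annihilates e r
    & forall s : nat, 0 < s -> annihilates e s -> r <= s].

End BinaryOperations.

(* Main.v *)
Require Import Defs.
From mathcomp Require Import all_boot.
From mathcomp Require Import boolp classical_sets functions cardinality.
From mathcomp Require Import zify.

(** Suppose every element is neutral.  Each [e] then commutes with each [x]
    inside the arguments of [F]: writing [x] as [F (x, e, ..., e)] and moving the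
    inner [F] one step to the left turns [e, x] into
    [F (e, x, e, ..., e), e = x, e].  So [F] is symmetric.  For a fixed [e], put
    [G x y = F (x, y, e, ..., e)]; associativity makes the right fold of [G] over
    a list equal to [F] of that list padded with copies of [e].  Hence [F] is the
    n-ary extension of [G], and [x ^ (n - 1) = F (x, ..., x, e) = e] since [x] is
    neutral, which also provides inverses. *)

Set Implicit Arguments.
Unset Strict Implicit.
Unset Printing Implicit Defensive.

Lemma cat_nseq_cons (T : Type) (k : nat) (x : T) (s : seq T) :
  nseq k x ++ x :: s = x :: nseq k x ++ s.
Proof. by elim: k => //= k ->. Qed.

(** * Associativity and symmetry of [F], expressed on lists *)

Section SequenceEvaluation.
Variables (X : Type) (n : nat) (F : n.-tuple X -> X) (x0 : X).

(* Meant for sequences of length [n] only: others are truncated or padded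
   with [x0]. *)
Definition nary_eval (s : seq X) : X := F [tuple nth x0 s i | i < n].

Lemma nary_eval_tuple (t : n.-tuple X) : nary_eval t = F t.
Proof.
by congr F; apply: eq_from_tnth => i; rewrite tnth_mktuple (tnth_nth x0).
Qed.

(** Passes from the indexed form of associativity to lists: the inner [F] consumes the block [q], so
    its value stands at index [size p]. *)
Lemma eval_nest (p q r : seq X) :
    size q = n -> size p + size r = n.-1 ->
  F (nest F (nth x0 (p ++ q ++ r)) (size p))
    = nary_eval (p ++ nary_eval q :: r).
Proof.
move=> sq spr; congr F; apply: eq_from_tnth => j; rewrite !tnth_mktuple.
rewrite [in RHS]nth_cat [in LHS]nth_cat; case: ltnP => // pj.
case: eqP => [-> | /eqP npj].
  rewrite subnn /=; congr F; apply: eq_from_tnth => k; rewrite !tnth_mktuple.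
  by rewrite nth_cat ltnNge leq_addr /= addKn nth_cat sq ltn_ord.
have n_gt0 : 0 < n by apply: leq_ltn_trans (ltn_ord j).
have lt_pj : size p < j by rewrite ltn_neqAle eq_sym npj.
rewrite nth_cat ltnNge (leq_trans pj (leq_addr _ _)) /= nth_cat sq.
(* Past the inner value, the source index is shifted by [n - 1], hence lies beyond the whole block
   [q]. *)
have -> : j + n.-1 - size p = n + (j - size p).-1 by lia.
rewrite ltnNge leq_addr /= addKn.
by case: (j - size p) (subn_gt0 (size p) j) => [|m]; rewrite ?lt_pj.
Qed.

Hypothesis F_assoc : nary_associative F.

Lemma nest0 (x : nat -> X) (i : nat) :
  i < n -> F (nest F x i) = F (nest F x 0).
Proof. by elim: i => // i IHi lt_in; rewrite -F_assoc // IHi // ltnW. Qed.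

(** Both sides bracket the same list of length [2n - 1], and every bracketing equals the one whose
    inner block starts at index 0. *)
Lemma nary_eval_assoc (p q r p' q' r' : seq X) :
    p ++ q ++ r = p' ++ q' ++ r' -> size q = n -> size q' = n ->
    size p + size r = n.-1 -> 0 < n ->
  nary_eval (p ++ nary_eval q :: r) = nary_eval (p' ++ nary_eval q' :: r').
Proof.
move=> E sq sq' spr n_gt0.
have spr' : size p' + size r' = n.-1.
  have := congr1 size E; rewrite !size_cat sq sq' !(addnCA _ n) spr.
  by move/addnI.
by rewrite -!eval_nest // E !(@nest0 _ (size _)) //; lia.
Qed.

Lemma nary_eval_neutral (e x : X) (k l : nat) :
    neutral F e -> k + l.+1 = n ->
  nary_eval (nseq k e ++ x :: nseq l e) = x.
Proof.
move=> e_neutral kln; have lt_kn : k < n by rewrite -kln addnS ltnS leq_addr.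
rewrite -[RHS](e_neutral x (Ordinal lt_kn)).
congr F; apply: eq_from_tnth => j; rewrite !tnth_mktuple -val_eqE /=.
rewrite nth_cat size_nseq; case: (ltngtP j k) => [jk | kj | ->].
- by rewrite nth_nseq jk.
- have -> : j - k = (j - k).-1.+1 by lia.
  by rewrite /= nth_nseq ifT //; have := ltn_ord j; lia.
- by rewrite subnn.
Qed.

Lemma nary_eval_swap (e x : X) (p q : seq X) :
    neutral F e -> size p + size q + 2 = n ->
  nary_eval (p ++ e :: x :: q) = nary_eval (p ++ x :: e :: q).
Proof.
move=> e_neutral; rewrite addn2 => spq.
have xr : nary_eval (x :: nseq (size p + size q).+1 e) = x.
  by apply: (@nary_eval_neutral e x 0).
have xl : nary_eval (e :: x :: nseq (size p + size q) e) = x.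
  by apply: (@nary_eval_neutral e x 1).
(* The two inner blocks now lie one place apart in the common list [p, e, x, e, ..., e, q]. *)
rewrite -{1}xr -{2}xl -cat_rcons.
apply: nary_eval_assoc; rewrite -?spq ?size_rcons //= ?size_nseq //.
by rewrite cat_rcons cat_nseq_cons.
Qed.

Lemma nary_eval_move (x : X) (p q r : seq X) :
    (forall e, neutral F e) -> size p + size q + size r + 1 = n ->
  nary_eval (p ++ x :: q ++ r) = nary_eval (p ++ q ++ x :: r).
Proof.
move=> neutralF; elim: q p => //= y q IHq p spqr.
rewrite nary_eval_swap //; last first.
  by rewrite -spqr size_cat !addnS !addnA.
by rewrite -!(cat_rcons y) IHq // size_rcons addSnnS.
Qed.

End SequenceEvaluation.

(** * Right folds and exponents for a binary operation *)

Section BinaryFolds.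
Variables (X : Type) (G : X -> X -> X) (e : X).

Lemma foldr_nseq (m : nat) (x : X) : foldr G e (nseq m x) = iter m (G x) e.
Proof. by elim: m => //= m ->. Qed.

(** Each [merge_last] carries out the innermost product of the right fold; the final [e] of the fold
    is absorbed by the last entry. *)
Lemma iterated_op_foldr (m : nat) (x : m.+1.-tuple X) :
  right_id e G -> iterated_op G x = foldr G e x.
Proof.
move=> Ge; elim: m x => [|m IHm] x /=.
  by case/tupleP: x => a x; rewrite tuple0 theadE /= Ge.
rewrite {}IHm.
have -> : merge_last G x
            = take m x ++ [:: G (nth e x m) (nth e x m.+1)] :> seq X.
  apply: (@eq_from_nth _ e) => [|i].
    by rewrite size_tuple size_cat size_takel size_tuple //= ?addn1 // ltnW.
  rewrite size_tuple => lt_im.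
  rewrite -[i]/(val (Ordinal lt_im)) -tnth_nth tnth_mktuple /=.
  rewrite nth_cat size_takel ?size_tuple; last exact: leqW.
  case: ltnP => [lt_i | le_mi].
    by rewrite nth_take // (tnth_nth e) inordK //; lia.
  have -> : i = m by lia.
  by rewrite subnn !(tnth_nth e) !inordK.
rewrite -[in RHS](cat_take_drop m x) !foldr_cat.
rewrite (drop_nth e) ?size_tuple // (drop_nth e) ?size_tuple // drop_oversize ?size_tuple //=.
by rewrite !Ge.
Qed.

Lemma nary_extension_foldr (n : nat) (F : n.-tuple X -> X) :
    0 < n -> right_id e G ->
  nary_extension G F <-> (forall t : n.-tuple X, F t = foldr G e t).
Proof.
case: n F => // n F _ Ge; split=> [extF t | foldF t y /val_inj <-].
  by rewrite (extF t t) // iterated_op_foldr.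
by rewrite iterated_op_foldr.
Qed.

Lemma annihilatesE (r : nat) :
  right_id e G -> annihilates G e r <-> forall x, iter r (G x) e = e.
Proof.
move=> Ge; have iterE x : iterop r G x e = iter r (G x) e.
  by case: r => // m; rewrite iteropS iterSr Ge.
by split=> H x; have := H x; rewrite iterE.
Qed.

Lemma iter_dvdn (r m : nat) (x : X) :
  iter r (G x) e = e -> r %| m -> iter m (G x) e = e.
Proof.
by move=> xr /dvdnP[k ->]; elim: k => //= k IHk; rewrite mulSn iterD IHk.
Qed.

(** For the least annihilating [r], the remainder of [m] modulo [r] annihilates as well, so
    minimality forces it to be 0. *)
Lemma exponent_dvdn (m : nat) :
    right_id e G -> 0 < m -> annihilates G e m ->
  exists2 r, group_exponent G e r & r %| m.
Proof.
move=> Ge m_gt0 Gm.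
pose P r := (0 < r) && `[< annihilates G e r >].
have exP : exists r, P r by exists m; rewrite /P m_gt0; apply/asboolP.
case: (ex_minnP exP) => r /andP[r_gt0 /asboolP Gr] r_min.
have {}r_min s : 0 < s -> annihilates G e s -> r <= s.
  by move=> s_gt0 Gs; apply: r_min; rewrite /P s_gt0; apply/asboolP.
exists r => //; rewrite /dvdn; case: (posnP (m %% r)) => [//|mr_gt0].
suff /(r_min _ mr_gt0) : annihilates G e (m %% r) by rewrite leqNgt ltn_mod r_gt0.
apply/annihilatesE => // x; move/annihilatesE: Gr => /(_ Ge x) xr.
move/annihilatesE: Gm => /(_ Ge x); rewrite {1}(divn_eq m r) addnC iterD.
by rewrite (iter_dvdn xr) // dvdn_mull.
Qed.

End BinaryFolds.

(** * The group obtained by fixing a neutral element *)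

Section NeutralToGroup.
Variables (X : Type) (n : nat) (F : n.-tuple X -> X) (e : X).
Hypotheses (n_ge2 : 2 <= n) (F_assoc : nary_associative F).
Hypothesis F_neutral : forall a, neutral F a.

Let ev := nary_eval F e.

Definition binary_reduct (x y : X) : X := ev (x :: y :: nseq (n - 2) e).
Let G := binary_reduct.

Lemma reduct_comm : commutative G.
Proof.
move=> x y; apply: (@nary_eval_swap _ _ _ _ F_assoc x y [::]) => //.
by rewrite size_nseq add0n subnK.
Qed.

Lemma reduct_left_id : left_id e G.
Proof.
by move=> y; apply: (@nary_eval_neutral _ _ _ e e y 1) => //; rewrite -addSnnS subnKC.
Qed.

Lemma reduct_right_id : right_id e G.
Proof. by move=> x; rewrite reduct_comm reduct_left_id. Qed.

Lemma reduct_assoc : associative G.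
Proof.
move=> x y z; rewrite /G /binary_reduct.
(* With [z] moved behind the copies of [e], both sides bracket [x, y, e, ..., e, z, e, ..., e]. *)
have -> : ev (y :: z :: nseq (n - 2) e) = ev (y :: nseq (n - 2) e ++ [:: z]).
  rewrite -[nseq (n - 2) e in LHS]cats0.
  apply: (@nary_eval_move _ _ _ e F_assoc z [:: y]) => //.
  by rewrite size_nseq addn0 addnAC subnKC.
apply: (@nary_eval_assoc _ _ _ _ F_assoc [:: x] _ _ [::]) => /=.
- by rewrite -catA.
- by rewrite size_cat size_nseq addn1 -addn2 subnK.
- by rewrite size_nseq -addn2 subnK.
- by rewrite size_nseq; lia.
- exact: ltnW.
Qed.

Lemma foldr_reduct (s : seq X) :
  size s <= n -> foldr G e s = ev (s ++ nseq (n - size s) e).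
Proof.
elim: s => [_ | x s IHs lt_sn] /=.
  rewrite subn0 -[in nseq n e](prednK (ltnW n_ge2)); symmetry.
  by apply: (@nary_eval_neutral _ _ _ e e e 0) => //; lia.
rewrite (IHs (ltnW lt_sn)) -[in LHS](subnSK lt_sn).
have size_xs : size (x :: s ++ nseq (n - (size s).+1) e) = n.
  by rewrite /= size_cat size_nseq -addSn subnKC.
(* The padding of [s] holds at least one [e]. Shifting the inner block one place left takes in [x]
   and releases that [e], which leaves a product with [e] on the right. *)
have -> : G x (ev (s ++ nseq (n - (size s).+1).+1 e))
          = ev (ev (x :: s ++ nseq (n - (size s).+1) e) :: e :: nseq (n - 2) e).
  apply: (@nary_eval_assoc _ _ _ _ F_assoc [:: x] _ _ [::]) => //=.
  - by rewrite -!catA cat_nseq_cons.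
  - by rewrite size_cat /= size_nseq subnSK // subnKC // ltnW.
  - by rewrite size_nseq; lia.
  - exact: ltnW.
exact: reduct_right_id.
Qed.

Lemma reduct_iter_pred (x : X) : iter n.-1 (G x) e = e.
Proof.
rewrite -foldr_nseq foldr_reduct size_nseq ?leq_pred //.
rewrite -subn1 subKn ?(ltnW n_ge2) //.
by apply: (@nary_eval_neutral _ _ _ e x e _ 0) => //; lia.
Qed.

(** The power [n - 2] of [x] is its inverse, since the power [n - 1] is [e]. *)
Lemma reduct_group : abelian_group G e (fun x => iter n.-2 (G x) e).
Proof.
split; [exact: reduct_assoc | exact: reduct_comm | exact: reduct_left_id |].
move=> x; rewrite reduct_comm -iterS.
by rewrite prednK ?reduct_iter_pred // -subn1 subn_gt0.
Qed.

Lemma reduct_extension : nary_extension G F.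
Proof.
apply/nary_extension_foldr; [exact: ltnW | exact: reduct_right_id | move=> t].
rewrite foldr_reduct size_tuple // subnn cats0.
by rewrite /ev nary_eval_tuple.
Qed.

End NeutralToGroup.

(** The converse direction: by commutativity the product of [x] and [n - 1] copies of [a] is [x]
    times the power [n - 1] of [a], which is [e] because [r] divides [n - 1]. *)
Lemma group_extension_neutral (X : Type) (n : nat) (F : n.-tuple X -> X)
    (G : X -> X -> X) (e : X) (inv : X -> X) (r : nat) :
    abelian_group G e inv -> annihilates G e r -> r %| n.-1 ->
    nary_extension G F ->
  forall a, neutral F a.
Proof.
case=> GA GC Ge _ Gr r_dvd extF a x k.
have eG : right_id e G by move=> y; rewrite GC Ge.
have n_gt0 : 0 < n by apply: leq_ltn_trans (ltn_ord k).
have [/(_ extF) -> _] := nary_extension_foldr F n_gt0 eG.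
have -> : [tuple if j == k then x else a | j < n]
          = nseq k a ++ x :: nseq (n.-1 - k) a :> seq X.
  have le_k : k <= n.-1 by rewrite -ltnS prednK.
  apply: (@eq_from_nth _ a) => [|i].
    by rewrite size_tuple size_cat /= !size_nseq addnS subnKC ?prednK.
  rewrite size_tuple => lt_in.
  rewrite -[i]/(val (Ordinal lt_in)) -tnth_nth tnth_mktuple -val_eqE /=.
  rewrite nth_cat size_nseq; case: (ltngtP i k) => [ik | ki | ->].
  - by rewrite nth_nseq ik.
  - move: ki; rewrite -subn_gt0; case: (i - k) => //= m _.
    by rewrite nth_nseq if_same.
  - by rewrite subnn.
(* This pulls [x] out in front, joining the copies of [a] on its two sides. *)
have foldG y s z : foldr G (G y z) s = G y (foldr G z s).
  by elim: s => //= w s ->; rewrite !GA (GC w).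
rewrite foldr_cat /= foldG -foldr_cat -nseqD foldr_nseq.
have k_le : k <= n.-1 by rewrite -ltnS prednK.
rewrite subnKC // (iter_dvdn _ r_dvd) //.
by move/annihilatesE: Gr; apply.
Qed.

Theorem theorem1p3 (X : Type) (n : nat) (F : n.-tuple X -> X)
  (hX : (`I_3 #<= [set: X]%classic)%card) (hn : 3 <= n)
  (hF : nary_associative F) :
  neutral_elements F = [set: X]%classic <->
  exists (G : X -> X -> X) (e : X) (inv : X -> X),
    [/\ abelian_group G e inv,
        exists2 r : nat, group_exponent G e r & r %| n - 1
      & nary_extension G F].
Proof.
split=> [allF | [G [e [inv [GG [r [_ Gr _] r_dvd] extF]]]]]; last first.
  apply/seteqP; split=> // a _.
  by apply: (group_extension_neutral GG Gr) => //; rewrite -subn1.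
have F_neutral a : neutral F a.
  by have : neutral_elements F a by rewrite allF.
(* An injection from a three-element set provides a point, which becomes the identity of the
   group. *)
have [e] : inhabited X.
  have /card_leP[f] := hX.
  have I0 : `I_3 0 by [].
  exact: (inhabits (val (f (SigSub (mem_set I0))))).
have n_ge2 := ltnW hn.
have GG := reduct_group e n_ge2 hF F_neutral.
exists (binary_reduct F e), e, (fun x => iter n.-2 (binary_reduct F e x) e).
split=> //; last exact: reduct_extension.
have eG := reduct_right_id e n_ge2 hF F_neutral.
apply: exponent_dvdn => //; first by rewrite subn_gt0.
by apply/annihilatesE => // x; rewrite subn1 reduct_iter_pred.
Qed.
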